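(* For every Noetherian space $X$, $\mathrm{sob}(X^\circledast) \geq (\omega \times ||X||) + 1$; equivalently, $\mathrm{rsob}(X^\circledast) \geq \omega \times ||X||$.
   Context: A topological space is Noetherian if every open subset is compact (every open cover has a finite subcover; no separation is required). For a well-founded poset $P$ and $x \in P$, $\mathrm{rk}_P(x) = \sup_{x' < x} (\mathrm{rk}_P(x')+1)$ and the ordinal rank of $P$ is $|P| = \sup_{x \in P} (\mathrm{rk}_P(x)+1)$, where $\sup\emptyset = 0$. $\mathcal{H}_0 X$ is the poset of all closed subsets of $X$ (including $\emptyset$), ordered by inclusion; it is well-founded when $X$ is Noetherian. The stature of a Noetherian space $X$ is $||X|| = |\mathcal{H}_0 X| - 1$, equivalently $||X|| = \mathrm{rk}_{\mathcal{H}_0 X}(X)$. A closed subset $C$ of $X$ is irreducible if it is non-empty and, whenever $C \subseteq F_1 \cup F_2$ with $F_1, F_2$ closed in $X$, we have $C \subseteq F_1$ or $C \subseteq F_2$. $\mathcal{S} X$ is the poset of irreducible closed subsets of $X$, ordered by inclusion. The sobrification rank of a Noetherian space $X$ is $\mathrm{sob}\, X = |\mathcal{S} X|$. When $X$ is non-empty, $\mathrm{sob}\, X$ is a successor ordinal and the reduced sobrification rank $\mathrm{rsob}\, X$ is $\mathrm{sob}\, X - 1$ (the ordinal whose successor is $\mathrm{sob}\, X$). $X^*$ is the set of finite words over $X$ with the word topology: the topology generated by the subsets $X^* U_1 X^* U_2 X^* \cdots X^* U_n X^*$ (concatenation of sets of words), where $n \in \mathbb{N}$ and $U_1, \ldots,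 U_n$ are open subsets of $X$. $X^\circledast$ is the set of finite multisets over $X$, i.e. maps $m \colon X \to \mathbb{N}$ with $m(x) = 0$ for all but finitely many $x$, with the quotient topology induced by the Parikh mapping $\Psi \colon X^* \to X^\circledast$, which maps a word $w$ to the multiset counting the number of occurrences of each $x \in X$ in $w$. $X^\circledast$ is Noetherian when $X$ is. The operation $\times$ between ordinals is ordinary ordinal multiplication, with $\alpha \times (\beta+1) = \alpha \times \beta + \alpha$ and continuous in its second argument; so if $\alpha = \omega^{\alpha_1} + \cdots + \omega^{\alpha_m}$ in Cantor normal form, $\omega \times \alpha = \omega^{1+\alpha_1} + \cdots + \omega^{1+\alpha_m}$. *)

(* Defs.v *)
From HB Require Import structures.
From mathcomp Require Import all_boot.
From mathcomp Require Import finmap multiset.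
From mathcomp Require Import boolp classical_sets topology.

Set Implicit Arguments.
Unset Strict Implicit.
Unset Printing Implicit Defensive.

Local Open Scope mset_scope.
Local Open Scope classical_set_scope.
Local Open Scope quotient_scope.

(* [OSup I f] is the ordinal sup_{i : I} (f i + 1), with sup over the empty
   type equal to 0. Every (small) ordinal is of this form, but not uniquely:
   equality of ordinals is [oeq], not Leibniz equality. *)
Inductive Ord : Type := OSup (I : Type) (f : I -> Ord).

Definition oidx (a : Ord) : Type := match a with @OSup J _ => J end.

Definition opart (a : Ord) : oidx a -> Ord :=
  match a with @OSup _ f => f end.

(* sup_i (f i + 1) <= b iff each f i < b, and a < b iff a <= b_j for some j. *)
Fixpoint ole (a b : Ord) {struct a} : Prop :=
  match a with @OSup J f => forall i : J, exists j : oidx b, ole (f i) (opart j) end.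

Definition oeq (a b : Ord) : Prop := ole a b /\ ole b a.

Definition ozero : Ord := OSup (fun e : Empty_set => match e with end).

Definition osucc (a : Ord) : Ord := OSup (fun _ : unit => a).

(* Least upper bound sup_i (f i), as opposed to sup_i (f i + 1). *)
Definition osup (I : Type) (f : I -> Ord) : Ord :=
  OSup (fun p : {i : I & oidx (f i)} => opart (projT2 p)).

(* The supremum of all ordinals < a; it is the predecessor a - 1 of a when a is
   a successor (and a itself when a is 0 or a limit). *)
Definition opred (a : Ord) : Ord := osup (@opart a).

(* a + b = max (a, sup_{b' < b} (a + b' + 1)). *)
Fixpoint oadd (a b : Ord) {struct b} : Ord :=
  match b with
  | @OSup J g => OSup (fun k : oidx a + J =>
                        match k with inl i => opart i | inr j => oadd a (g j) end)
  end.

(* a * b = sup_{b' < b} (a * b' + a). *)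
Fixpoint omul (a b : Ord) {struct b} : Ord :=
  match b with @OSup J g => osup (fun j : J => oadd (omul a (g j)) a) end.

Definition omega : Ord := OSup (fun n : nat => iter n osucc ozero).

Lemma ole_refl a : ole a a.
Proof. by elim: a => I f IH i; exists i; exact: IH. Qed.

Lemma ole_trans b a c : ole a b -> ole b c -> ole a c.
Proof.
elim: a b c => I f IH [J g] [K h] /= ab bc i.
have [j ij] := ab i; have [k jk] := bc j.
by exists k; exact: IH ij jk.
Qed.

Lemma oleE a b :
  ole a b <-> (forall i : oidx a, exists j : oidx b, ole (opart i) (opart j)).
Proof. by case: a. Qed.

Lemma osup_lub (I : Type) (f : I -> Ord) (b : Ord) :
  ole (osup f) b <-> (forall i, ole (f i) b).
Proof.
split=> [fb i|fb [i j]]; first by apply/oleE => j; exact: (fb (existT _ i j)).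
by have /oleE := fb i; apply.
Qed.

Lemma opred_succ a : oeq (opred (osucc a)) a.
Proof.
split; first by apply/osup_lub => -[]; exact: ole_refl.
by apply: (proj1 (osup_lub _ _) (ole_refl _) tt).
Qed.

(* Ranks with respect to a strict order [lt]. An element has a rank exactly
   when it is accessible; all elements are when [lt] is well-founded, which
   is the only case of interest. *)
Section Rank.
Variables (P : Type) (lt : P -> P -> Prop).

(* rk(x) = sup_{y < x} (rk(y) + 1). *)
Fixpoint rk (x : P) (a : Acc lt x) {struct a} : Ord :=
  OSup (fun y : {y : P | lt y x} => rk (Acc_inv a (proj2_sig y))).

Definition ordinal_rank : Ord :=
  OSup (fun x : {x : P | Acc lt x} => rk (proj2_sig x)).

End Rank.

Definition noetherian (X : topologicalType) : Prop :=
  forall U : set X, open U -> cover_compact U.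

Definition closed_subset (X : topologicalType) : Type :=
  {C : set X | closed C}.

Definition stature (X : topologicalType) : Ord :=
  opred (ordinal_rank (fun C D : closed_subset X => sval C `<` sval D)).

Definition irreducible (X : topologicalType) (C : set X) : Prop :=
  C !=set0 /\
  forall F1 F2 : set X, closed F1 -> closed F2 ->
    C `<=` F1 `|` F2 -> C `<=` F1 \/ C `<=` F2.

Definition irreducible_closed (X : topologicalType) : Type :=
  {C : set X | closed C /\ irreducible C}.

Definition sob (X : topologicalType) : Ord :=
  ordinal_rank (fun C D : irreducible_closed X => sval C `<` sval D).

Definition rsob (X : topologicalType) : Ord := opred (sob X).

Definition lang_cat (T : Type) (A B : set (seq T)) : set (seq T) :=
  [set u ++ v | u in A & v in B].

Definition letters (T : Type) (U : set T) : set (seq T) :=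
  [set [:: x] | x in U].

(* X^* U_1 X^* U_2 X^* ... X^* U_n X^* *)
Definition word_open (T : Type) (Us : seq (set T)) : set (seq T) :=
  foldr (fun U L => lang_cat setT (lang_cat (letters U) L)) setT Us.

Definition word_subbase (X : topologicalType) : set (set (seq X)) :=
  [set word_open Us |
    Us in [set Us : seq (set X) | forall U : set X, U \in Us -> open U]].

Definition words (X : Type) : Type := seq X.

HB.instance Definition _ (X : choiceType) := Choice.copy (words X) (seq X).

HB.instance Definition _ (X : topologicalType) :=
  @isSubBaseTopological.Build (words X) (set (words X))
    (@word_subbase X) id.

Definition multisets (X : choiceType) : Type := {mset X}.

(* The Parikh mapping is [seq_mset] (see [mset_seqE]). *)
Definition parikh (X : choiceType) (w : words X) : multisets X := seq_mset w.

Lemma parikhK (X : choiceType) :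
  cancel (fun m : multisets X => (m : {mset X}) : seq X) (@parikh X).
Proof. exact: seq_mset_id. Qed.

HB.instance Definition _ (X : choiceType) := Choice.copy (multisets X) {mset X}.

HB.instance Definition _ (X : choiceType) :=
  isQuotient.Build (words X) (multisets X) (@parikhK X).

Definition multiset_space (X : topologicalType) : topologicalType :=
  quotient_topology (multisets X : quotType (words X)).

Lemma multiset_openE (X : topologicalType) (U : set (multiset_space X)) :
  open U = open ((@parikh X) @^-1` U).
Proof.
rewrite (_ : @parikh X = \pi_(quotient_topology (multisets X))) //.
by apply/funext => w; rewrite pi.unlock.
Qed.

(* Main.v *)
Require Import Defs.
From mathcomp Require Import all_boot finmap multiset boolp classical_sets.
From mathcomp Require Import filter topology.

Set Implicit Arguments.
Unset Strict Implicit.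
Unset Printing Implicit Defensive.

Local Open Scope mset_scope.
Local Open Scope classical_set_scope.

(** Write C^* for the multisets over a closed set C of X.  It is closed, and
    irreducible: two multisets of C^* outside the closed sets F1 and F2 have a
    sum in C^* that lies outside both, because open sets of multisets are
    upward closed for inclusion.

    The point is that for closed D strictly inside C, the rank of C^* exceeds
    that of D^* by at least omega.  A minimal closed subset E of C that is not
    contained in D is irreducible.  For each n, let L_n be the multisets over
    D and E that have at most n elements, with multiplicity, outside D
    ([mostly_over]).  It is closed.  It is also irreducible
    ([mostly_over_irreducible]): after padding with elements of E, two members
    of L_n outside F1 and F2 have exactly n marked elements in E, the others
    being in D; add up their D-parts, and replace the marked elements one by
    one by common elements of E, which the irreducibility of E provides.
    Since
      D^* = L_0 < L_1 < L_2 < ... < C^*,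
    the gap is at least omega ([irr_rk_power_step]).  By induction on C, the
    rank of C^* is at least omega times the rank of C among the closed subsets
    of X ([omul_omega_rk]), and C = X gives the theorem.

    A rank is only available for elements of well-founded posets, so the
    irreducible closed sets of multisets must be shown to satisfy the
    descending chain condition.  As multisets are a continuous image of words,
    this is the topological form of Higman's lemma: words over a Noetherian
    space form a Noetherian space.  The proof characterises Noetherian sets
    as those A for which every ultrafilter containing A also contains the set
    of its own limits ([ultra_noetherian]).  This property passes to finite
    unions, products and continuous images in a few lines.  Higman's lemma
    ([words_over_ultra_noetherian]) follows by induction on the closed set C
    of letters: if an ultrafilter on words over C fails to converge to some
    word w, it contains the words over C that avoid a basic neighbourhood
    X^* U_1 X^* ... U_n X^* of w; they lie in a finite union of images
    of products, whose factors are copies of C and sets of words over the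
    smaller closed sets C minus U_i. *)

(** * Ordinals and ranks *)

Definition olt (a b : Ord) : Prop := exists j : oidx b, ole a (opart j).

Lemma opart_ole b (j : oidx b) : ole (opart j) b.
Proof. by elim: b j => J g IH j; apply/oleE => i; exists j; exact: IH. Qed.

Lemma olt_ole a b : olt a b -> ole a b.
Proof. by case=> j aj; exact: ole_trans aj (opart_ole j). Qed.

Lemma ole_olt_trans b a c : ole a b -> olt b c -> olt a c.
Proof. by move=> ab [j bj]; exists j; exact: ole_trans ab bj. Qed.

Lemma osucc_ole a b : olt a b -> ole (osucc a) b.
Proof. by move=> [j aj] /= _; exists j. Qed.

Lemma oadd0_ole a b : ole a b -> ole (oadd a ozero) b.
Proof. by move=> /oleE ab [i|[]]; exact: ab. Qed.

Lemma oadd_osucc_ole a b c :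
  ole a c -> olt (oadd a b) c -> ole (oadd a (osucc b)) c.
Proof. by move=> /oleE ac abc [i|[]] /=; [exact: ac|exact: abc]. Qed.

Lemma oadd_omega_ole a c :
  ole a c -> (forall n, olt (oadd a (iter n osucc ozero)) c) ->
  ole (oadd a omega) c.
Proof. by move=> /oleE ac anc [i|n] /=; [exact: ac|exact: anc]. Qed.

Lemma omul_ole a b c :
  (forall j : oidx b, ole (oadd (omul a (opart j)) a) c) -> ole (omul a b) c.
Proof. by case: b => J g abc; apply/osup_lub. Qed.

Section RankTheory.
Variables (P : Type) (lt : P -> P -> Prop).

(** Ordinals are only compared up to [oeq], but this holds as an equality, which
    lets the recursive clause of [omul] be rewritten along a rank. *)
Lemma rk_opart x (a : Acc lt x) (i : oidx (rk a)) :
  exists y (b : Acc lt y), lt y x /\ opart i = rk b.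
Proof. by case: a i => wx [y yx] /=; exists y, (wx y yx). Qed.

Lemma rk_lt x y (a : Acc lt x) (b : Acc lt y) : lt y x -> olt (rk b) (rk a).
Proof.
case: a => wx yx; exists (exist _ y yx) => /=.
by rewrite (Prop_irrelevance b (wx y yx)); exact: ole_refl.
Qed.

Lemma rk_lt_ordinal_rank x (a : Acc lt x) : olt (rk a) (ordinal_rank lt).
Proof. by exists (exist _ x a); exact: ole_refl. Qed.

End RankTheory.

(** * Noetherian sets through ultrafilters *)

(** An ultrafilter is characterised by deciding every set, and F decides the
    preimages under f. *)
Lemma ultra_fmap (S T : Type) (f : S -> T) (F : set_system S) :
  UltraFilter F -> UltraFilter (f @ F).
Proof.
move=> FU; split; first exact: fmap_proper_filter.
move=> G GF FG; apply/seteqP; split => // A GA.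
have [//|FnA] := in_ultra_setVsetC (f @^-1` A) FU.
have GnA : G (~` A) by apply: FG.
by have [y []] := filter_ex (filterI GA GnA).
Qed.

Section UltraNoetherian.
Context {Y : topologicalType}.

(** Compactness of A asks that every ultrafilter F containing A have a limit in
    A.  If this holds for all subsets of A, then no member of F inside A can
    miss the limits of F, so that the set of limits belongs to F. *)
Definition ultra_noetherian (A : set Y) : Prop :=
  forall F : set_system Y, UltraFilter F -> F A -> F [set y | F --> y].

Lemma ultra_noetherian_sub (A B : set Y) :
  A `<=` B -> ultra_noetherian B -> ultra_noetherian A.
Proof. by move=> AB nB F FU FA; apply: nB => //; exact: filterS AB FA. Qed.

Lemma ultra_noetherianU (A B : set Y) :
  ultra_noetherian A -> ultra_noetherian B -> ultra_noetherian (A `|` B).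
Proof.
move=> nA nB F FU FAB; have [FA|FnA] := in_ultra_setVsetC A FU.
  exact: nA.
apply: nB => //; apply: filterS (filterI FAB FnA) => y [[Ay|//] nAy].
by case: nAy.
Qed.

Lemma ultra_noetherian0 : ultra_noetherian (@set0 Y).
Proof. by move=> F FU F0; have [] := filter_ex F0. Qed.

(** The points that are not limits of F form the union of the open sets outside
    F.  Were this open set in F, compactness would cover it by
    finitely many sets outside F. *)
Lemma noetherian_ultra : noetherian Y -> ultra_noetherian (@setT Y).
Proof.
move=> nY F FU _.
pose D := [set O : set Y | open O /\ ~ F O].
have limE : ~` (\bigcup_(O in D) O) `<=` [set y | F --> y].
  move=> y yD A; rewrite nbhsE => -[O [oO Oy] OA].
  apply: filterS OA _; apply: contrapT => nFO; apply: yD.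
  by exists O.
suff: ~ F (\bigcup_(O in D) O).
  have [//|] := in_ultra_setVsetC (\bigcup_(O in D) O) FU.
  by move=> FC _; exact: filterS limE FC.
move=> FD.
have oD : open (\bigcup_(O in D) O) by apply: bigcup_open => O [].
have [E ED DE] := nY _ oD _ D id (fun O DO => proj1 DO) (@subset_refl _ _).
have FE : F (\bigcap_(O in [set` E]) ~` O).
  apply: filter_bigI => O /ED; rewrite inE => -[_ nFO].
  by have [] := in_ultra_setVsetC O FU.
have [y [/DE [O EO Oy] yE]] := filter_ex (filterI FD FE).
exact: yE EO Oy.
Qed.

(** On an infinite strict descent C_0 > C_1 > ... choose x_n in C_n outside
    C_(n+1), and an ultrafilter G containing all tails of the sequence x.  Some
    x_i is a limit of G, hence the complement of C_(i+1) is in G; yet so is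
    C_(i+1), which contains a tail. *)
Lemma ultra_noetherian_wf : ultra_noetherian (@setT Y) ->
  well_founded (fun C D : closed_subset Y => sval C `<` sval D).
Proof.
set lt := (X in well_founded X).
move=> nY C0; apply: contrapT => nC0.
have step (C : {C | ~ Acc lt C}) :
    {D : {C | ~ Acc lt C} | lt (sval D) (sval C)}.
  apply: cid; case: C => C nC; apply: contrapT => noD; case: (nC).
  split=> D DC; apply: contrapT => nD; apply: noD.
  by exists (exist _ D nD).
have [Cs [_ Csdecr]] := dependent_choice step (exist _ C0 nC0).
pose C n := sval (sval (Cs n)).
have Cn n : C n.+1 `<` C n := Csdecr n.
have Cmono m n : (m <= n)%N -> C n `<=` C m.
  elim: n => [|n IH]; first by rewrite leqn0 => /eqP ->.
  rewrite leq_eqVlt => /predU1P [->//|]; rewrite ltnS => /IH.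
  by apply: subset_trans; exact: properW (Cn n).
have /choice [x xP] n : exists y, (C n `\` C n.+1) y.
  have [_ /existsNP [y /not_implyP [Cy nCy]]] := Cn n.
  by exists y.
have [G [GU xG]] := ultraFilterLemma (_ : ProperFilter (x @ \oo)).
have GX : G (range x) by apply: xG; exists 0%N => // n _; exists n.
have [_ [[i _ <-] Gxi]] := filter_ex (filterI GX (nY G GU filterT)).
have GnC : G (~` C i.+1).
  apply: Gxi; apply: open_nbhs_nbhs; split; last exact: (xP i).2.
  by apply: closed_openC; exact: svalP (sval (Cs i.+1)).
have GC : G (C i.+1).
  by apply: xG; exists i.+1 => // n /= lt_in; exact: Cmono lt_in _ (xP n).1.
by have [y []] := filter_ex (filterI GC GnC).
Qed.

End UltraNoetherian.

(** An ultrafilter F containing f @` A is the image under f of an ultrafilter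
    containing A, namely of its image under a section g of f. *)
Lemma ultra_noetherian_image (Y Z : topologicalType) (f : Y -> Z) (A : set Y) :
  continuous f -> ultra_noetherian A -> ultra_noetherian (f @` A).
Proof.
move=> cf nA F FU FfA.
(* Off f @` A, the section g takes the default value y0. *)
have [_ [y0 _ _]] := filter_ex FfA.
have /choice [g gP] z : exists y, (f @` A) z -> A y /\ f y = z.
  by case: (pselect ((f @` A) z)) => [[y Ay fy]|nz]; [exists y|exists y0].
have gU := ultra_fmap g FU.
have GA : F (g @^-1` A) by apply: filterS FfA => z /gP [].
have Glim : F [set z | g @ F --> g z] := nA _ gU GA.
apply: filterS (filterI FfA Glim) => z [fAz /= Gz] O Oz.
have fGz : f @ (g @ F) --> z.
  have <- := (gP z fAz).2.
  exact: cvg_trans (cvg_app f Gz) (cf (g z)).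
have FO : F (g @^-1` (f @^-1` O)) := fGz O Oz.
by apply: filterS (filterI FfA FO) => t [fAt /=]; rewrite (gP t fAt).2.
Qed.

(** A pair is a limit of F as soon as its components are limits of the two
    projections of F, and each of these events has full F-measure. *)
Lemma ultra_noetherianX (Y Z : topologicalType) (A : set Y) (B : set Z) :
  ultra_noetherian A -> ultra_noetherian B -> ultra_noetherian (A `*` B).
Proof.
move=> nA nB F FU FAB.
have FA : F (fst @^-1` A) by apply: filterS FAB => p [].
have FB : F (snd @^-1` B) by apply: filterS FAB => p [].
have lim1 : F [set p | fst @ F --> p.1] := nA _ (ultra_fmap fst FU) FA.
have lim2 : F [set p | snd @ F --> p.2] := nB _ (ultra_fmap snd FU) FB.
apply: filterS (filterI lim1 lim2) => p [/= F1 F2] O [[P Q] [/= Pp Qp] PQO].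
have FP : F (fst @^-1` P) := F1 _ Pp.
have FQ : F (snd @^-1` Q) := F2 _ Qp.
by apply: filterS (filterI FP FQ) => q ?; exact: PQO.
Qed.

(** * Irreducible closed sets *)

(** The form in which irreducibility is used: nonempty relatively open subsets
    of E meet. *)
Lemma irreducible_meet (X : topologicalType) (E U V : set X) :
  irreducible E -> open U -> open V ->
  (exists x, E x /\ U x) -> (exists x, E x /\ V x) ->
  exists x, [/\ E x, U x & V x].
Proof.
move=> [_ irrE] oU oV [x [Ex Ux]] [y [Ey Vy]]; apply: contrapT => noUV.
have [||z Ez|EU|EV] := irrE (~` U) (~` V).
- exact: open_closedC.
- exact: open_closedC.
- have [Uz|] := pselect (U z); last by left.
  by right=> Vz; apply: noUV; exists z.
- exact: EU Ex Ux.
- exact: EV Ey Vy.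
Qed.

(** A minimal closed subset of C that is not contained in D is irreducible: if
    it is covered by F1 and F2 but contained in neither, then its traces on F1
    and F2 are smaller, so they lie in D, and so does their union. *)
Lemma exists_irreducible_notin (X : topologicalType) (D : set X)
    (C : closed_subset X) :
  well_founded (fun A B : closed_subset X => sval A `<` sval B) ->
  ~ (sval C `<=` D) ->
  exists E, [/\ closed E, irreducible E, E `<=` sval C & ~ (E `<=` D)].
Proof.
move=> wfX; have := wfX C; elim=> {}C _ IH nCD.
have [[B [BC nBD]]|minC] :=
  pselect (exists B : closed_subset X, sval B `<` sval C /\ ~ sval B `<=` D).
  have [E [cE irrE EB nED]] := IH B BC nBD.
  by exists E; split => //; exact: subset_trans EB (properW BC).
exists (sval C); split => //; first exact: svalP C.
split; first by have /existsNP [x /not_implyP [Cx _]] := nCD; exists x.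
move=> F1 F2 cF1 cF2 CF; apply: contrapT => /not_orP [nCF1 nCF2]; apply: nCD.
have traceD F : closed F -> ~ (sval C `<=` F) -> sval C `&` F `<=` D.
  move=> cF nCF; apply: contrapT => nD; apply: minC.
  exists (exist _ _ (closedI (svalP C) cF)); split => //; split=> [x []//|CCF].
  by apply: nCF => x /CCF [].
by move=> x Cx; have [Fx|Fx] := CF x Cx;
  [exact: (traceD F1)|exact: (traceD F2)].
Qed.

(** * Words and subwords *)

Section WordOpen.
Variable T : eqType.
Implicit Types (U : set T) (Us : seq (set T)) (s u v w : seq T).

Lemma word_open_nil U Us : ~ word_open (U :: Us) [::].
Proof. by case=> u _ [_ [_ [x _ <-] [v _ <-]]]; case: u. Qed.

(** With this recursion on the word, all facts about [word_open] follow by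
    induction without handling concatenations of languages. *)
Lemma word_open_cons U Us x w :
  word_open (U :: Us) (x :: w) <->
  (U x /\ word_open Us w) \/ word_open (U :: Us) w.
Proof.
split=> [[[|y u] _ [_ [_ [z Uz <-] [v Usv <-]]]]|[[Ux Usw]|]].
- by move=> /= [<- <-]; left.
- move=> /= [_ <-]; right; exists u => //.
  by exists ([:: z] ++ v) => //; exists [:: z]; [exists z|exists v].
- exists [::] => //; exists (x :: w) => //.
  by exists [:: x]; [exists x|exists w].
- by move=> [u _ [v Uv <-]]; exists (x :: u) => //; exists v.
Qed.

Lemma word_open_subseq Us u v : subseq u v -> word_open Us u -> word_open Us v.
Proof.
elim: v u Us => [|y v IH] [|x u] [|U Us] //=.
  by move=> _ /word_open_nil.
case: eqP => [<- uv|_ xuv] /word_open_cons Usu; apply/word_open_cons.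
  case: Usu => [[Ux Usu]|Usu]; [left; split|right] => //; exact: IH Usu.
right; apply: (IH (x :: u)) => //; exact/word_open_cons.
Qed.

Lemma word_open_cat Us u v : word_open Us (u ++ v) <->
  exists Us1 Us2, [/\ Us = Us1 ++ Us2, word_open Us1 u & word_open Us2 v].
Proof.
split.
  elim: u Us => [|x u IH] [|U Us] /=; try by exists [::], [::].
    by move=> Usv; exists [::], (U :: Us).
  move=> /word_open_cons [[Ux /IH [Us1 [Us2 [-> Us1u Us2v]]]]|
                          /IH [[|U' Us1] [Us2 [E Us1u Us2v]]]].
  - by exists (U :: Us1), Us2; split => //; apply/word_open_cons; left.
  - by exists [::], Us2.
  - exists (U' :: Us1), Us2; split => //; apply/word_open_cons; right.
    exact: Us1u.
move=> [Us1 [Us2 [-> ]]]; elim: u Us1 => [|x u IH] [|U Us1] //=.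
- by move=> /word_open_nil.
- by move=> _; apply: word_open_subseq; rewrite -cat_cons suffix_subseq.
- move=> /word_open_cons Us1u Us2v; apply/word_open_cons.
  case: Us1u => [[Ux Us1u]|Us1u]; first by left; split => //; exact: IH.
  by right; exact: (IH (U :: Us1)).
Qed.

Lemma word_open_mem Us w U :
  word_open Us w -> U \in Us -> exists2 x, x \in w & U x.
Proof.
elim: w Us => [|x w IH] [|V Us] //; first by move=> /word_open_nil.
move=> /word_open_cons [[Vx Usw]|VUsw] UVUs.
  move: UVUs; rewrite inE => /predU1P [->|/(IH _ Usw) [y yw Uy]].
    by exists x; rewrite ?mem_head.
  by exists y; rewrite // inE yw orbT.
by have [y yw Uy] := IH _ VUsw UVUs; exists y; rewrite // inE yw orbT.
Qed.

Lemma word_open_nseq U n w :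
  word_open (nseq n U) w <-> (n <= count (fun x => `[< U x >]) w)%N.
Proof.
elim: w n => [|x w IH] [|n] //=; first by split=> // /word_open_nil.
split=> [/word_open_cons [[/asboolP -> /IH]|/(IH n.+1)]|].
- by rewrite add1n ltnS.
- by move=> /= /leq_trans; apply; exact: leq_addl.
- case: (asboolP (U x)) => [Ux|_]; rewrite ?add1n ?ltnS ?add0n => nw.
    by apply/word_open_cons; left; split => //; exact/IH.
  by apply/word_open_cons; right; exact/(IH n.+1).
Qed.

End WordOpen.

Definition words_over (T : eqType) (C : set T) : set (seq T) :=
  [set w : seq T | forall x, x \in w -> C x].

Lemma words_over_cat (T : eqType) (C : set T) u v :
  words_over C (u ++ v) <-> words_over C u /\ words_over C v.
Proof.
split=> [Cuv|[Cu Cv] x]; last by rewrite mem_cat => /orP [/Cu|/Cv].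
by split=> x xu; apply: Cuv; rewrite mem_cat xu ?orbT.
Qed.

Lemma words_over_cons (T : eqType) (C : set T) x w :
  words_over C (x :: w) <-> C x /\ words_over C w.
Proof.
split=> [Cxw|[Cx Cw] y]; last by rewrite inE => /predU1P [->//|/Cw].
by split=> [|y yw]; apply: Cxw; rewrite inE ?eqxx ?yw ?orbT.
Qed.

(** * The word topology is Noetherian *)

Section WordTopology.
Variable X : topologicalType.
Implicit Types (U : set X) (Us : seq (set X)) (w : words X).

Lemma open_word_open Us :
  (forall U, U \in Us -> open U) -> open (word_open Us : set (words X)).
Proof.
move=> oUs; exists [set word_open Us]; last by rewrite bigcup_set1.
by move=> _ ->; apply: finI_from1; exists Us.
Qed.

(** The sets [word_open Us] are only a subbase, which is enough to test
    convergence; so their finite intersections never have to be computed. *)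
Lemma word_cvg (F : set_system (words X)) w : Filter F ->
  (forall Us, (forall U, U \in Us -> open U) ->
     word_open Us w -> F (word_open Us)) ->
  F --> w.
Proof.
move=> FF Fw A; rewrite nbhsE => -[O [[B Bfin <-] [V BV Vw]] BA].
apply: filterS BA _; apply: filterS (bigcup_sup BV) _.
have [E Esub EV] := Bfin V BV; rewrite -EV in Vw *.
apply: filter_bigI => L LE; have := Esub L LE.
rewrite inE => -[Us oUs UsL]; rewrite -UsL; apply: Fw => //.
rewrite UsL; exact: Vw.
Qed.

Lemma word_cat_continuous :
  continuous (fun p : words X * words X => (p.1 ++ p.2 : words X)).
Proof.
move=> [u v]; apply: word_cvg => Us oUs.
move=> /word_open_cat [Us1 [Us2 [E Us1u Us2v]]].
exists (word_open Us1, word_open Us2) => /=.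
  by split; apply: open_nbhs_nbhs; split => //; apply: open_word_open => U UUs;
     apply: oUs; rewrite E mem_cat UUs ?orbT.
by move=> [u' v'] [/= Us1u' Us2v']; apply/word_open_cat; exists Us1, Us2.
Qed.

Lemma letter_continuous : continuous (fun x : X => ([:: x] : words X)).
Proof.
move=> x; apply: word_cvg => -[|U Us] oUs; first by move=> _; exact: filterT.
move=> /word_open_cons [[Ux Us0]|/word_open_nil //].
apply: (@filterS _ _ _ U); first by move=> y Uy; apply/word_open_cons; left.
by apply: open_nbhs_nbhs; split => //; apply: oUs; exact: mem_head.
Qed.

(** The basic open sets are upward closed, so the principal filter of v
    converges to every subword u of v. *)
Lemma open_words_subseq (O : set (words X)) (u v : words X) :
  open O -> subseq u v -> O u -> O v.
Proof.
move=> oO uv Ou.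
have vu : principal_filter v --> u.
  apply: word_cvg => Us _ Usu; apply/principal_filterP.
  exact: word_open_subseq uv Usu.
by apply/principal_filterP; apply: vu; exact: open_nbhs_nbhs.
Qed.

Lemma insert_letter_continuous (u v : words X) :
  continuous (fun x : X => (u ++ x :: v : words X)).
Proof.
move=> x; apply: word_cvg => Us oUs.
rewrite -cat1s => /word_open_cat [Us1 [Us' [E1 Us1u]]].
move=> /word_open_cat [Us2 [Us3 [E2 Us2x Us3v]]].
have oUs2 : open (word_open Us2 : set (words X)).
  apply: open_word_open => U UUs; apply: oUs.
  by rewrite E1 E2 !mem_cat UUs orbT.
have := letter_continuous (open_nbhs_nbhs (conj oUs2 Us2x)).
apply: (@filterS _ (nbhs x)) => y Us2y.
rewrite /= -[y :: v]cat1s; apply/word_open_cat; exists Us1, Us'; split => //.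
by apply/word_open_cat; exists Us2, Us3.
Qed.

(** A word over C that avoids X^* U X^* U_2 ... X^* either has no letter in U,
    or splits at its first letter in U as u x v, with u over C minus U and v
    avoiding X^* U_2 ... X^*.  So these words lie in the union of one
    Noetherian set with the image of a product of Noetherian sets. *)
Lemma words_avoiding_ultra_noetherian (C : set X) Us :
  ultra_noetherian C ->
  (forall U, U \in Us ->
     ultra_noetherian (words_over (C `\` U) : set (words X))) ->
  ultra_noetherian (words_over C `\` word_open Us : set (words X)).
Proof.
move=> nC; elim: Us => [_|U Us IH nUs].
  rewrite (_ : _ `\` _ = set0); first exact: ultra_noetherian0.
  by apply/seteqP; split => // w [_ []].
have nDU := nUs U (mem_head U Us).
have {}IH := IH (fun V VUs => nUs V (mem_behead (s := U :: Us) VUs)).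
pose cat2 (p : words X * words X) : words X := p.1 ++ p.2.
pose letter (x : X) : words X := [:: x].
apply: (@ultra_noetherian_sub (words X) _
  (words_over (C `\` U) `|`
   cat2 @` (words_over (C `\` U) `*`
     cat2 @` ((letter @` C) `*` (words_over C `\` word_open Us))))); last first.
  apply: ultra_noetherianU => //.
  apply: (ultra_noetherian_image word_cat_continuous).
  apply: ultra_noetherianX => //.
  apply: (ultra_noetherian_image word_cat_continuous).
  apply: ultra_noetherianX => //.
  exact: (ultra_noetherian_image letter_continuous).
move=> w []; elim: w => [|x w IHw]; first by left.
move=> /words_over_cons [Cx Cw] nUUs.
have nUUsw : ~ word_open (U :: Us) w.
  by move=> UUsw; apply: nUUs; apply/word_open_cons; right.
have [Ux|nUx] := pselect (U x).
  right; exists (([::] : words X), (x :: w : words X)) => //; split => //.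
  exists (letter x, (w : words X)) => //; split; first by exists x.
  by split => //= Usw; apply: nUUs; apply/word_open_cons; left.
have [CUw|[[u v] [/= CUu vP]]] := IHw Cw nUUsw.
  by left; apply/words_over_cons.
move=> <-; right; exists ((x :: u : words X), (v : words X)) => //.
by split => //; apply/words_over_cons.
Qed.

(** Topological Higman lemma, by well-founded induction on the closed set C of
    letters.  If w over C is in [word_open Us], then each U in Us meets C, so
    C minus U is strictly smaller than C. *)
Lemma words_over_ultra_noetherian : noetherian X ->
  forall C : set X, closed C -> ultra_noetherian (words_over C : set (words X)).
Proof.
move=> nX C0 cC0; have nT := noetherian_ultra nX.
have := ultra_noetherian_wf nT (exist _ C0 cC0).
rewrite -[C0]/(sval (exist _ C0 cC0)).
elim=> {cC0} -[C cC] _ IH F FU FC /=.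
(* Either F misses a basic neighbourhood of a word over C, or it converges to
   all words over C. *)
have [[w [Us [oUs Cw Usw nFUs]]]|lim] := pselect (exists w Us,
    [/\ forall U, U \in Us -> open U, words_over C w, word_open Us w
      & ~ F (word_open Us)]).
  have nFC : ultra_noetherian (words_over C `\` word_open Us : set (words X)).
    apply: words_avoiding_ultra_noetherian => [|U UUs].
      exact: ultra_noetherian_sub nT.
    have cCU : closed (C `\` U).
      by apply: closedI => //; apply: open_closedC; exact: oUs.
    apply: (IH (exist _ _ cCU)); split; first by move=> x [].
    have [x xw Ux] := word_open_mem Usw UUs.
    by move=> /(_ x (Cw x xw)) [].
  apply: nFC; have [//|FnUs] := in_ultra_setVsetC (word_open Us) FU.
  exact: filterI FC FnUs.
apply: filterS FC => w Cw; apply: word_cvg => Us oUs Usw.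
by apply: contrapT => nFUs; apply: lim; exists w, Us.
Qed.

End WordTopology.

(** * Irreducible closed sets of multisets *)

Section Bags.
Variable X : topologicalType.
Implicit Types (L : set (words X)) (C D E : set X) (u v w : words X).

Definition bag L : set (multiset_space X) := [set parikh w | w in L].

Definition perm_invariant L := forall u v, perm_eq u v -> L u -> L v.

Lemma parikh_preimage_perm (A : set (multiset_space X)) :
  perm_invariant (@parikh X @^-1` A).
Proof. move=> u v /eq_seq_msetP uv; by rewrite /preimage /= /parikh uv. Qed.

Lemma bag_preimage L : perm_invariant L -> @parikh X @^-1` bag L = L.
Proof.
move=> pL; apply/seteqP; split=> [w [u Lu uw]|w Lw]; last by exists w.
by apply: pL Lu; apply/eq_seq_msetP.
Qed.

Lemma parikh_surj (m : multiset_space X) : exists w : words X, parikh w = m.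
Proof. by exists ((m : {mset X}) : seq X); exact: parikhK. Qed.

Lemma parikh_continuous :
  continuous (@parikh X : words X -> multiset_space X).
Proof. by apply/continuousP => O; rewrite multiset_openE. Qed.

Lemma bag_closed L : perm_invariant L -> closed L -> closed (bag L).
Proof.
move=> pL cL; rewrite -openC multiset_openE.
have -> : @parikh X @^-1` (~` bag L) = ~` L.
  by rewrite -[in RHS](bag_preimage pL).
exact: closed_openC.
Qed.

(** Irreducibility of a set of multisets, expressed on words; there one may
    reorder letters freely, since only permutation-invariant open sets occur. *)
Lemma bag_irreducible L : perm_invariant L -> L !=set0 ->
  (forall O1 O2 : set (words X), open O1 -> open O2 ->
    perm_invariant O1 -> perm_invariant O2 ->
    forall u v, L u -> L v -> O1 u -> O2 v ->
    exists w, [/\ L w, O1 w & O2 w]) ->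
  irreducible (bag L).
Proof.
move=> pL [w Lw] Lconn; split; first by exists (parikh w), w.
move=> F1 F2 cF1 cF2 LF; apply: contrapT => /not_orP [].
move=> /existsNP [_ /not_implyP [[u Lu <-] nF1]].
move=> /existsNP [_ /not_implyP [[v Lv <-] nF2]].
have oF (F : set (multiset_space X)) : closed F -> open (@parikh X @^-1` ~` F).
  by move=> /closed_openC; rewrite multiset_openE.
have [t [Lt nF1t nF2t]] := Lconn _ _ (oF _ cF1) (oF _ cF2)
  (@parikh_preimage_perm (~` F1)) (@parikh_preimage_perm (~` F2))
  _ _ Lu Lv nF1 nF2.
by have [|] : (F1 `|` F2) (parikh t) by apply: LF; exists t.
Qed.

Lemma bag_proper L L' : perm_invariant L ->
  L `<` L' -> bag L `<` bag L'.
Proof.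
move=> pL [LL' nL'L]; split.
  by move=> _ [w Lw <-]; exists w => //; exact: LL'.
move=> sub; apply: nL'L => w L'w; rewrite -(bag_preimage pL).
by apply: sub; exists w.
Qed.

Lemma words_over_perm C : perm_invariant (words_over C).
Proof. by move=> u v uv Cu x; rewrite -(perm_mem uv) => /Cu. Qed.

Lemma words_over_closed C : closed C -> closed (words_over C : set (words X)).
Proof.
move=> cC; rewrite -openC.
(* Some letter is outside C. *)
rewrite (_ : ~` _ = word_open [:: ~` C]); last first.
  apply/seteqP; split => w.
    move=> /existsNP [x /not_implyP [xw nCx]].
    have [p1 p2] := splitPr xw; exists p1 => //; exists (x :: p2) => //.
    by exists [:: x]; [exists x|exists p2].
  move=> nCw Cw; have [x xw nCx] := word_open_mem nCw (mem_head _ _).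
  exact: nCx (Cw x xw).
by apply: open_word_open => U; rewrite inE => /eqP ->; exact: closed_openC.
Qed.

(** Concatenating two words over C gives a word over C that lies in every open
    set containing one of them. *)
Lemma power_irreducible C : irreducible (bag (words_over C)).
Proof.
apply: bag_irreducible; [exact: words_over_perm|by exists [::]|].
move=> O1 O2 oO1 oO2 _ _ u v Cu Cv O1u O2v; exists (u ++ v); split.
- by apply/words_over_cat.
- exact: open_words_subseq oO1 (prefix_subseq u v) O1u.
- exact: open_words_subseq oO2 (suffix_subseq u v) O2v.
Qed.

Definition outside D : pred X := fun x => `[< (~` D) x >].

Lemma count_outside0 D w : words_over D w -> count (outside D) w = 0%N.
Proof.
move=> Dw; apply/eqP; rewrite -leqn0 leqNgt -has_count; apply/hasPn => x xw.
by apply/asboolPn; apply; exact: Dw.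
Qed.

(** The words of the n-th layer above D^*.  Bounding the number of letters
    outside D, rather than in E, is what makes the layer closed when E meets
    D. *)
Definition mostly_over D E (n : nat) : set (words X) :=
  words_over (D `|` E) `&` [set w | (count (outside D) w <= n)%N].

Lemma mostly_over_perm D E n : perm_invariant (mostly_over D E n).
Proof.
move=> u v uv [DEu nu]; split; first exact: words_over_perm uv DEu.
by rewrite /= -(permP uv).
Qed.

Lemma mostly_over_closed D E n :
  closed D -> closed E -> closed (mostly_over D E n).
Proof.
move=> cD cE; apply: closedI; first by apply: words_over_closed; exact: closedU.
(* At least n + 1 letters are outside D. *)
rewrite -openC (_ : ~` _ = word_open (nseq n.+1 (~` D))).
  apply: open_word_open => U; rewrite mem_nseq => /eqP ->.
  exact: closed_openC.
apply/seteqP; split => w; rewrite word_open_nseq /=.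
  by move/negP; rewrite -ltnNge.
by rewrite ltnNge => /negP.
Qed.

(** The words e and e' are traded for a common word f letter by letter: the
    letters that keep the word in O1, and those that keep it in O2, form open
    sets that meet E, hence they have an element in common in E. *)
Lemma merge_letters E (O1 O2 : set (words X)) : irreducible E ->
  open O1 -> open O2 ->
  forall p e e' d, size e = size e' -> words_over E e -> words_over E e' ->
  O1 (p ++ e ++ d) -> O2 (p ++ e' ++ d) ->
  exists f, [/\ size f = size e, words_over E f,
                O1 (p ++ f ++ d) & O2 (p ++ f ++ d)].
Proof.
move=> irrE oO1 oO2 p e; elim: e p => [|x e IH] p [|x' e'] d //.
  by exists [::].
move=> [see'] /words_over_cons [Ex Ee] /words_over_cons [Ex' Ee'] O1e O2e'.
have open_at (O : set (words X)) s : open O ->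
    open [set y | O (p ++ y :: s)].
  by move=> oO; have /continuousP/(_ O oO) := @insert_letter_continuous X p s.
have [y [Ey O1y O2y]] := irreducible_meet irrE
  (open_at O1 (e ++ d) oO1) (open_at O2 (e' ++ d) oO2)
  (ex_intro _ x (conj Ex O1e)) (ex_intro _ x' (conj Ex' O2e')).
have [||f [sf Ef O1f O2f]] := IH (rcons p y) e' d see' Ee Ee'.
- by rewrite cat_rcons.
- by rewrite cat_rcons.
- exists (y :: f); split; rewrite -?cat_rcons //=; first by rewrite sf.
  exact/words_over_cons.
Qed.

(** Exactly n marked letters in E make two words of [mostly_over D E n]
    fit for [merge_letters]; the padding letter may lie in D.  Reordering and
    adding letters are both harmless for permutation-invariant open sets. *)
Lemma mostly_over_pad D E n u : E !=set0 -> mostly_over D E n u ->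
  exists e d, [/\ size e = n, words_over E e, words_over D d &
    exists2 u', perm_eq u u' & subseq u' (e ++ d)].
Proof.
move=> [x0 Ex0] [DEu nu]; rewrite /= -size_filter in nu.
set far := [seq x <- u | outside D x] in nu *.
set near := [seq x <- u | predC (outside D) x].
exists (far ++ nseq (n - size far) x0), near; split.
- by rewrite size_cat size_nseq subnKC.
- apply/words_over_cat; split=> x.
  2: by rewrite mem_nseq => /andP [_ /eqP ->].
  by rewrite mem_filter => /andP [/asboolP nDx /DEu []].
- by move=> x; rewrite mem_filter => /andP [/asboolPn /contrapT].
- exists (far ++ near); first by rewrite perm_sym perm_filterC.
  by apply: cat_subseq => //; exact: prefix_subseq.
Qed.

Lemma mostly_over_irreducible D E n :
  irreducible E -> irreducible (bag (mostly_over D E n)).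
Proof.
move=> irrE; apply: bag_irreducible; first exact: mostly_over_perm.
  by exists [::]; split.
move=> O1 O2 oO1 oO2 pO1 pO2 u v Lu Lv O1u O2v.
have [e [d [se Ee Dd [u' uu' u'ed]]]] := mostly_over_pad irrE.1 Lu.
have [e' [d' [se' Ee' Dd' [v' vv' v'ed]]]] := mostly_over_pad irrE.1 Lv.
have O1e : O1 (e ++ (d ++ d')).
  apply: open_words_subseq oO1 _ (pO1 _ _ uu' O1u).
  by rewrite catA; exact: subseq_trans u'ed (prefix_subseq _ _).
have O2e' : O2 (e' ++ (d ++ d')).
  apply: open_words_subseq oO2 _ (pO2 _ _ vv' O2v).
  apply: subseq_trans v'ed _; apply: cat_subseq => //; exact: suffix_subseq.
have [|f [sf Ef O1f O2f]] :=
    merge_letters (p := [::]) irrE oO1 oO2 _ Ee Ee' O1e O2e'.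
  by rewrite se se'.
exists (f ++ (d ++ d')); split => //; split.
  apply/words_over_cat; split=> [x /Ef|x]; first by right.
  by rewrite mem_cat => /orP [/Dd|/Dd']; left.
rewrite /= !count_cat (count_outside0 Dd) (count_outside0 Dd') !addn0.
by rewrite -se -sf count_size.
Qed.

Lemma mostly_over0 D E : mostly_over D E 0 = words_over D.
Proof.
apply/seteqP; split=> w.
  move=> [_ w0] x xw; apply: contrapT => nDx.
  move: w0; rewrite /= leqn0 => /eqP w0.
  have : has (outside D) w by apply/hasP; exists x => //; exact/asboolP.
  by rewrite has_count w0.
move=> Dw; split; first by move=> x /Dw; left.
by rewrite /= (count_outside0 Dw).
Qed.

Lemma mostly_over_nseq D E n k x : E x -> ~ D x ->
  mostly_over D E n (nseq k x) <-> (k <= n)%N.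
Proof.
move=> Ex nDx; have ox : outside D x by exact/asboolP.
rewrite /mostly_over /setI /= count_nseq ox mul1n; split=> [[]//|kn].
by split=> // y; rewrite mem_nseq => /andP [_ /eqP ->]; right.
Qed.

Lemma mostly_over_proper D E n : ~ (E `<=` D) ->
  mostly_over D E n `<` mostly_over D E n.+1.
Proof.
move=> /existsNP [x /not_implyP [Ex nDx]]; split.
  by move=> w [DEw /= wn]; split => //=; exact: leqW.
move=> /(_ (nseq n.+1 x)).
by rewrite !(mostly_over_nseq _ _ Ex nDx) ltnn => /(_ (leqnn _)).
Qed.

Lemma mostly_over_power D E C n : D `<=` C -> E `<=` C -> ~ (E `<=` D) ->
  mostly_over D E n `<` words_over C.
Proof.
move=> DC EC /existsNP [x /not_implyP [Ex nDx]]; split.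
  by move=> w [DEw _] y /DEw [/DC|/EC].
move=> /(_ (nseq n.+1 x)); rewrite (mostly_over_nseq _ _ Ex nDx) ltnn => H.
suff : false by [].
by apply: H => y; rewrite mem_nseq => /andP [_ /eqP ->]; exact: EC.
Qed.

End Bags.

(** * The lower bound *)

Section LowerBound.
Variable X : topologicalType.
Hypothesis nX : noetherian X.

Local Notation cl_lt := (fun C D : closed_subset X => sval C `<` sval D).
Local Notation irr_lt := (fun A B : irreducible_closed (multiset_space X) =>
  sval A `<` sval B).

Lemma closed_subset_wf : well_founded cl_lt.
Proof. exact: ultra_noetherian_wf (noetherian_ultra nX). Qed.

Lemma multiset_ultra_noetherian : ultra_noetherian [set: multiset_space X].
Proof.
apply: (@ultra_noetherian_sub _ _
  ((@parikh X : words X -> multiset_space X) @` words_over setT)).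
  by move=> m _; have [w <-] := parikh_surj m; exists w.
apply: (ultra_noetherian_image (@parikh_continuous X)).
by apply: words_over_ultra_noetherian => //; exact: closedT.
Qed.

Lemma irreducible_closed_wf : well_founded irr_lt.
Proof.
move=> A; pose cl (B : irreducible_closed (multiset_space X)) :
  closed_subset (multiset_space X) := exist _ (sval B) (svalP B).1.
have := ultra_noetherian_wf multiset_ultra_noetherian (cl A).
move E : (cl A) => C aC; elim: aC A E => {}C _ IH A CA.
by split=> B BA; apply: IH (erefl (cl B)); rewrite -CA.
Qed.

Definition irr_rk A := rk (irreducible_closed_wf A).

Lemma irr_rk_lt A B : sval A `<` sval B -> olt (irr_rk A) (irr_rk B).
Proof. exact: (@rk_lt _ irr_lt). Qed.

Lemma irr_rk_le A B : sval A `<=` sval B -> ole (irr_rk A) (irr_rk B).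
Proof.
move=> AB; have [BA|nBA] := pselect (sval B `<=` sval A).
  rewrite (_ : A = B); first exact: ole_refl.
  by apply: eq_sig_hprop => [C p q|]; [exact: Prop_irrelevance|exact/seteqP].
exact/olt_ole/irr_rk_lt.
Qed.

Definition power (C : closed_subset X) :
  irreducible_closed (multiset_space X) := exist _ (bag (words_over (sval C)))
    (conj (bag_closed (@words_over_perm X (sval C))
                      (words_over_closed (svalP C)))
          (power_irreducible (sval C))).

(** The layers D^* = L_0 < L_1 < ... stay strictly below C^*, and each raises
    the rank by at least one. *)
Lemma irr_rk_power_step (o : Ord) (D C : closed_subset X) :
  sval D `<` sval C -> ole o (irr_rk (power D)) ->
  ole (oadd o omega) (irr_rk (power C)).
Proof.
move=> [DC nCD] oD.
have [E [cE irrE EC nED]] := exists_irreducible_notin closed_subset_wf nCD.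
pose layer n : irreducible_closed (multiset_space X) :=
  exist _ (bag (mostly_over (sval D) E n))
    (conj (bag_closed (@mostly_over_perm X (sval D) E n)
                      (mostly_over_closed (svalP D) cE (n := n)))
          (mostly_over_irreducible (sval D) n irrE)).
have layer_lt n : olt (irr_rk (layer n)) (irr_rk (layer n.+1)).
  apply: irr_rk_lt; apply: bag_proper; first exact: mostly_over_perm.
  exact: mostly_over_proper.
have layer_power n : olt (irr_rk (layer n)) (irr_rk (power C)).
  apply: irr_rk_lt; apply: bag_proper; first exact: mostly_over_perm.
  exact: mostly_over_power.
have o_layer n : ole o (irr_rk (layer n)).
  elim: n => [|n /ole_trans]; last by apply; exact/olt_ole/layer_lt.
  by apply: ole_trans oD _; apply: irr_rk_le; rewrite /= mostly_over0.
have on_layer n : ole (oadd o (iter n osucc ozero)) (irr_rk (layer n)).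
  elim: n => [|n IH]; first exact: oadd0_ole (o_layer 0%N).
  by apply: oadd_osucc_ole => //; exact: ole_olt_trans IH (layer_lt n).
apply: oadd_omega_ole.
  by apply: ole_trans (o_layer 0%N) _; exact/olt_ole/layer_power.
by move=> n; exact: ole_olt_trans (on_layer n) (layer_power n).
Qed.

Lemma omul_omega_rk (C : closed_subset X) (aC : Acc cl_lt C) :
  ole (omul omega (rk aC)) (irr_rk (power C)).
Proof.
have accC := aC; elim: accC aC => {}C _ IH aC; apply: omul_ole => j.
have [D [aD [DC ->]]] := rk_opart j.
by apply: (irr_rk_power_step DC); exact: (IH D DC aD).
Qed.

Lemma omul_omega_stature :
  olt (omul omega (stature X)) (sob (multiset_space X)).
Proof.
pose XT : closed_subset X := exist _ setT closedT.
have rk_sob := rk_lt_ordinal_rank (irreducible_closed_wf (power XT)).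
apply: ole_olt_trans rk_sob; apply: omul_ole => -[[C aC] j] /=.
have [D [aD [DC ->]]] := rk_opart j.
apply: (irr_rk_power_step (D := D)); last exact: omul_omega_rk.
by split=> // TD; case: DC => _; apply => x _; exact: TD.
Qed.

End LowerBound.

Theorem proposition14p9 (X : topologicalType) (hX : noetherian X) :
  ole (osucc (omul omega (stature X))) (sob (multiset_space X)) /\
  ole (omul omega (stature X)) (rsob (multiset_space X)).
Proof.
have lt_sob := omul_omega_stature hX.
split; first exact: osucc_ole.
case: lt_sob => j oj; apply: ole_trans oj _.
exact: (proj1 (osup_lub _ _) (ole_refl _) j).
Qed.
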